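(* Let $(Q,\&,k)$ be a unital quantale with at least two elements. Then the functor $\mathscr{P}\colon \mathsf{Set}(Q)^{\mathrm{op}}\to\mathsf{Set}(Q)$ is right adjoint to the functor $\mathscr{P}^\dag\colon\mathsf{Set}(Q)\to\mathsf{Set}(Q)^{\mathrm{op}}$.
   Context: A unital quantale $(Q,\&,k)$ is a monoid with unit $k$ whose underlying set $Q$ is a complete lattice (top $1$, bottom $0$) such that $\&$ distributes over arbitrary suprema in each variable. For $p,q,r\in Q$ put $r/q=\bigvee\{p\in Q\mid p\,\&\,q\le r\}$ and $p\backslash r=\bigvee\{q\in Q\mid p\,\&\,q\le r\}$. For a set $X$ and $\lambda,\gamma\in Q^X$ put $\lambda\swarrow\gamma=\bigwedge_{x\in X}\lambda(x)/\gamma(x)$ and $\gamma\searrow\lambda=\bigwedge_{x\in X}\gamma(x)\backslash\lambda(x)$. The Goguen category $\mathsf{Set}(Q)$ has as objects the pairs $(X,\alpha)$ with $X$ a set and $\alpha\colon X\to Q$ a map; a morphism (Goguen map) $f\colon(X,\alpha)\to(Y,\beta)$ is a map $f\colon X\to Y$ with $\alpha(x)\le\beta(f(x))$ for all $x\in X$; composition is that of maps. On objects, $\mathscr{P}(X,\alpha)=(Q^X,\alpha^\uparrow)$ and $\mathscr{P}^\dag(X,\alpha)=(Q^X,\alpha_\dag^\uparrow)$, where $\alpha^\uparrow(\gamma)=\gamma\swarrow\alpha$ and $\alpha_\dag^\uparrow(\gamma)=\alpha\searrow\gamma$ for $\gamma\in Q^X$. Both functors send a Goguen map $f\colon(X,\alpha)\to(Y,\beta)$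 to the map $Q^Y\to Q^X$, $\lambda\mapsto\lambda\circ f$, regarded as a Goguen map $(Q^Y,\beta^\uparrow)\to(Q^X,\alpha^\uparrow)$ for $\mathscr{P}$ and $(Q^Y,\beta_\dag^\uparrow)\to(Q^X,\alpha_\dag^\uparrow)$ for $\mathscr{P}^\dag$. *)

(* Defs.v *)
From HB Require Import structures.
From mathcomp Require Import all_boot all_order.
From mathcomp Require Import boolp classical_sets.

Set Implicit Arguments.
Unset Strict Implicit.
Unset Printing Implicit Defensive.

Local Open Scope order_scope.
Local Open Scope classical_set_scope.

(* Complete lattices: partial orders in which every subset, the empty one      *)
(* included, has a supremum and an infimum. The library operators supremum and *)
(* infimum are not used: they return their default value on the empty set.     *)
HB.mixin Record POrder_isCompleteLattice d T of Order.POrder d T := {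
  qsup : set T -> T;
  qinf : set T -> T;
  qsup_supremums : forall A : set T, supremums A (qsup A);
  qinf_infimums : forall A : set T, infimums A (qinf A)
}.

#[short(type="completeLatticeType")]
HB.structure Definition CompleteLattice d :=
  {T of POrder_isCompleteLattice d T & Order.POrder d T}.

(* The product p & q of the quantale is (p * q)%g, and its unit k is 1%g.      *)
HB.mixin Record isQuantale d T of CompleteLattice d T & Monoid T := {
  mulq_supr : forall (p : T) (A : set T),
    (p * qsup A)%g = qsup [set (p * q)%g | q in A];
  mulq_supl : forall (q : T) (A : set T),
    (qsup A * q)%g = qsup [set (p * q)%g | p in A]
}.

#[short(type="unitalQuantaleType")]
HB.structure Definition UnitalQuantale d :=
  {T of isQuantale d T & CompleteLattice d T & Monoid T}.

Section Residuals.
Context {d : Order.disp_t} {Q : unitalQuantaleType d}.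
Implicit Types p q r : Q.

(* r / q *)
Definition rresid r q : Q := qsup [set p | (p * q)%g <= r].
(* p \ r *)
Definition lresid p r : Q := qsup [set q | (p * q)%g <= r].

(* lambda \swarrow gamma *)
Definition swarrow (X : Type) (lambda gamma : X -> Q) : Q :=
  qinf (range (fun x => rresid (lambda x) (gamma x))).
(* gamma \searrow lambda *)
Definition searrow (X : Type) (gamma lambda : X -> Q) : Q :=
  qinf (range (fun x => lresid (gamma x) (lambda x))).

Lemma qsup_ub (A : set Q) p : A p -> p <= qsup A.
Proof. by move=> Ap; case: (qsup_supremums A) => ub _; apply: ub. Qed.

Lemma qsup_le (A : set Q) r : (forall p, A p -> p <= r) -> qsup A <= r.
Proof. by move=> Ar; case: (qsup_supremums A) => _; apply. Qed.

Lemma qinf_lb (A : set Q) p : A p -> qinf A <= p.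
Proof. by move=> Ap; case: (qinf_infimums A) => lb _; apply: lb. Qed.

Lemma qinf_ge (A : set Q) r : (forall p, A p -> r <= p) -> r <= qinf A.
Proof. by move=> Ar; case: (qinf_infimums A) => _; apply. Qed.

Lemma qsup_pair p q : p <= q -> qsup [set p; q] = q.
Proof.
move=> pq; apply: Order.POrderTheory.le_anti; apply/andP; split.
  by apply: qsup_le => _ [->|->].
by apply: qsup_ub; right.
Qed.

Lemma mulq_monor p q r : q <= r -> (p * q)%g <= (p * r)%g.
Proof.
move=> qr; rewrite -[in leRHS](qsup_pair qr) mulq_supr.
by apply: qsup_ub; exists q => //; left.
Qed.

Lemma mulq_monol p q r : p <= q -> (p * r)%g <= (q * r)%g.
Proof.
move=> pq; rewrite -[in leRHS](qsup_pair pq) mulq_supl.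
by apply: qsup_ub; exists p => //; left.
Qed.

Lemma rresid_anti p q r : p <= q -> rresid r q <= rresid r p.
Proof.
move=> pq; apply: qsup_le => s /= sq; apply: qsup_ub => /=.
exact: Order.POrderTheory.le_trans (mulq_monor s pq) sq.
Qed.

Lemma lresid_anti p q r : p <= q -> lresid q r <= lresid p r.
Proof.
move=> pq; apply: qsup_le => s /= qs; apply: qsup_ub => /=.
exact: Order.POrderTheory.le_trans (mulq_monol s pq) qs.
Qed.

End Residuals.

Record category := Category {
  obj :> Type;
  hom : obj -> obj -> Type;
  idm : forall a, hom a a;
  comp : forall a b c, hom b c -> hom a b -> hom a c;
  compm1 : forall a b (f : hom a b), comp f (idm a) = f;
  comp1m : forall a b (f : hom a b), comp (idm b) f = f;
  compA : forall a b c e (h : hom c e) (g : hom b c) (f : hom a b),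
    comp h (comp g f) = comp (comp h g) f
}.

Definition op (C : category) : category :=
  @Category C (fun a b => hom b a) (@idm C)
    (fun a b c g f => comp f g)
    (fun a b f => comp1m f) (fun a b f => compm1 f)
    (fun a b c e h g f => esym (compA f g h)).

Record functor (C D : category) := Functor {
  fobj :> C -> D;
  fmap : forall a b : C, hom a b -> hom (fobj a) (fobj b);
  fmap1 : forall a : C, fmap (idm a) = idm (fobj a);
  fmapM : forall (a b c : C) (g : hom b c) (f : hom a b),
    fmap (comp g f) = comp (fmap g) (fmap f)
}.

(* F -| G *)
Record adjunction (C D : category) (F : functor C D) (G : functor D C) :=
  Adjunction {
  transpose : forall (c : C) (e : D), hom (F c) e -> hom c (G e);
  transpose_bij : forall (c : C) (e : D), bijective (@transpose c e);
  transpose_natl : forall (c c' : C) (e : D) (u : hom c' c) (h : hom (F c) e),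
    transpose (comp h (fmap F u)) = comp (transpose h) u;
  transpose_natr : forall (c : C) (e e' : D) (v : hom e e') (h : hom (F c) e),
    transpose (comp v h) = comp (fmap G v) (transpose h)
}.

Definition is_right_adjoint_to (C D : category)
    (G : functor D C) (F : functor C D) : Prop :=
  inhabited (adjunction F G).

Section Goguen.
Context {d : Order.disp_t} (Q : unitalQuantaleType d).

Record goguen_obj := GoguenObj {
  carrier :> Type;
  degree : carrier -> Q
}.

Record goguen_map (A B : goguen_obj) := GoguenMap {
  gfun :> A -> B;
  gfunP : forall x : A, degree x <= degree (gfun x)
}.

Lemma goguen_map_eq (A B : goguen_obj) (f g : goguen_map A B) :
  gfun f = gfun g -> f = g.
Proof.
case: f g => [f fP] [g gP] /= fg; case: _ / fg in gP *.
by rewrite (Prop_irrelevance fP gP).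
Qed.

Definition goguen_id (A : goguen_obj) : goguen_map A A :=
  @GoguenMap A A id (fun x => Order.POrderTheory.lexx (degree x)).

Definition goguen_comp (A B C : goguen_obj)
    (g : goguen_map B C) (f : goguen_map A B) : goguen_map A C :=
  @GoguenMap A C (g \o f)
    (fun x => Order.POrderTheory.le_trans (gfunP f x) (gfunP g (f x))).

Definition SetQ : category.
Proof.
refine (@Category goguen_obj goguen_map goguen_id goguen_comp _ _ _).
- by move=> A B f; apply: goguen_map_eq.
- by move=> A B f; apply: goguen_map_eq.
- by move=> A B C D h g f; apply: goguen_map_eq.
Defined.

Definition P_obj (A : goguen_obj) : goguen_obj :=
  @GoguenObj (A -> Q) (fun gamma => swarrow gamma (@degree A)).

Definition Pdag_obj (A : goguen_obj) : goguen_obj :=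
  @GoguenObj (A -> Q) (fun gamma => searrow (@degree A) gamma).

Lemma P_mapP (A B : goguen_obj) (f : goguen_map A B) (lambda : P_obj B) :
  degree lambda <= @degree (P_obj A) (lambda \o f).
Proof.
apply: qinf_ge => _ [x _ <-].
apply: Order.POrderTheory.le_trans (rresid_anti _ (gfunP f x)).
by apply: qinf_lb; exists (f x).
Qed.

Lemma Pdag_mapP (A B : goguen_obj) (f : goguen_map A B) (lambda : Pdag_obj B) :
  degree lambda <= @degree (Pdag_obj A) (lambda \o f).
Proof.
apply: qinf_ge => _ [x _ <-].
apply: Order.POrderTheory.le_trans (lresid_anti _ (gfunP f x)).
by apply: qinf_lb; exists (f x).
Qed.

Definition P_map (A B : goguen_obj) (f : goguen_map A B) :
    goguen_map (P_obj B) (P_obj A) :=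
  @GoguenMap (P_obj B) (P_obj A) (fun lambda => lambda \o f) (P_mapP f).

Definition Pdag_map (A B : goguen_obj) (f : goguen_map A B) :
    goguen_map (Pdag_obj B) (Pdag_obj A) :=
  @GoguenMap (Pdag_obj B) (Pdag_obj A) (fun lambda => lambda \o f)
    (Pdag_mapP f).

Definition P_functor : functor (op SetQ) SetQ.
Proof.
refine (@Functor (op SetQ) SetQ P_obj (fun A B f => @P_map B A f) _ _).
- by move=> A; apply: goguen_map_eq.
- by move=> A B C g f; apply: goguen_map_eq.
Defined.

Definition Pdag_functor : functor SetQ (op SetQ).
Proof.
refine (@Functor SetQ (op SetQ) Pdag_obj Pdag_map _ _).
- by move=> A; apply: goguen_map_eq.
- by move=> A B C g f; apply: goguen_map_eq.
Defined.

End Goguen.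

(* Main.v *)
Require Import Defs.
From mathcomp Require Import all_boot all_order.
From mathcomp Require Import classical_sets.

(** A map h : B -> Q^A and a map A -> Q^B are the same thing as a function of
two variables, so exchanging the arguments is the only candidate for the
transposition. It restricts to Goguen maps because both degree conditions
unfold to one and the same inequality
  degree a & degree b <= h b a  for all a and b.
For h : B -> P^dag A this is the adjunction between p & - and p \ -
([le_searrow]); for the exchanged map A -> P B it is the adjunction between
- & q and - / q ([le_swarrow]). This is why the two different functors P^dag
and P occur: the product is not commutative, and exchanging the variables
exchanges left and right residuals. Naturality is immediate, since both
functors act by precomposition. *)

Local Open Scope order_scope.
Local Open Scope classical_set_scope.

Section ResidualAdjunctions.
Context {d : Order.disp_t} {Q : unitalQuantaleType d}.
Implicit Types p q r : Q.

(** Distributivity over suprema makes the supremum that defines r / q belong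
to the set of which it is the supremum. *)
Lemma le_rresid p q r : p <= rresid r q <-> (p * q)%g <= r.
Proof.
split=> [p_le|pq_le]; last exact: qsup_ub.
apply: Order.POrderTheory.le_trans (mulq_monol _ p_le) _.
by rewrite mulq_supl; apply: qsup_le => _ [s sq_le <-].
Qed.

Lemma le_lresid p q r : q <= lresid p r <-> (p * q)%g <= r.
Proof.
split=> [q_le|pq_le]; last exact: qsup_ub.
apply: Order.POrderTheory.le_trans (mulq_monor _ q_le) _.
by rewrite mulq_supr; apply: qsup_le => _ [s ps_le <-].
Qed.

Lemma le_qinf_range (X : Type) (f : X -> Q) p :
  p <= qinf (range f) <-> forall x, p <= f x.
Proof.
split=> [p_le x|p_le]; last by apply: qinf_ge => _ [x _ <-].
by apply: Order.POrderTheory.le_trans p_le _; apply: qinf_lb; exists x.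
Qed.

Lemma le_swarrow (X : Type) (lambda gamma : X -> Q) p :
  p <= swarrow lambda gamma <-> forall x, (p * gamma x)%g <= lambda x.
Proof.
by split=> [/le_qinf_range p_le x|p_le]; [|apply/le_qinf_range => x];
  apply/le_rresid.
Qed.

Lemma le_searrow (X : Type) (gamma lambda : X -> Q) q :
  q <= searrow gamma lambda <-> forall x, (gamma x * q)%g <= lambda x.
Proof.
by split=> [/le_qinf_range q_le x|q_le]; [|apply/le_qinf_range => x];
  apply/le_lresid.
Qed.

End ResidualAdjunctions.

Section Transposition.
Context {d : Order.disp_t} {Q : unitalQuantaleType d}.
Implicit Types A B : goguen_obj Q.

Lemma goguen_swapP A B (h : goguen_map B (Pdag_obj A)) (a : A) :
  degree a <= @degree _ _ (P_obj B) (fun b => h b a).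
Proof. by apply/le_swarrow => b; exact: (le_searrow _ _ _ _).1 (gfunP h b) a. Qed.

Lemma goguen_unswapP A B (g : goguen_map A (P_obj B)) (b : B) :
  degree b <= @degree _ _ (Pdag_obj A) (fun a => g a b).
Proof. by apply/le_searrow => a; exact: (le_swarrow _ _ _ _).1 (gfunP g a) b. Qed.

Definition goguen_swap A B (h : goguen_map B (Pdag_obj A)) :
    goguen_map A (P_obj B) :=
  @GoguenMap _ _ A (P_obj B) (fun a b => h b a) (goguen_swapP A B h).

Definition goguen_unswap A B (g : goguen_map A (P_obj B)) :
    goguen_map B (Pdag_obj A) :=
  @GoguenMap _ _ B (Pdag_obj A) (fun b a => g a b) (goguen_unswapP A B g).

Lemma goguen_swap_bij A B : bijective (goguen_swap A B).
Proof. by exists (goguen_unswap A B) => f; apply: goguen_map_eq. Qed.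

End Transposition.

Theorem proposition4p2 (d : Order.disp_t) (Q : unitalQuantaleType d)
    (Q_ge2 : exists p q : Q, p <> q) :
  is_right_adjoint_to (P_functor Q) (Pdag_functor Q).
Proof.
constructor.
(* A morphism P^dag A -> B of the opposite category is a Goguen map from B to
   P^dag A. *)
apply: (@Adjunction (SetQ Q) (op (SetQ Q)) (Pdag_functor Q) (P_functor Q)
  (fun A B => goguen_swap A B)).
- exact: goguen_swap_bij.
- by move=> A A' B u h; apply: goguen_map_eq.
- by move=> A B B' v h; apply: goguen_map_eq.
Qed.
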